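(* Let $T^n=\mathbb{R}^n/\mathbb{Z}^n$. Let $G$ be the collection of all subsets of $T^n$ of the form $W_1\cap\dots\cap W_q$ where $W_1,\dots,W_q$ are toric subspaces, and let $L$ be the distributive lattice of subsets of $T^n$ obtained from $G$ by finite intersections, finite unions and complements. Then there is a valuation $v$ on $L$ with values in $\mathbb{Z}[t]$ such that $v(V)=t^k$ for every $k$-dimensional toric subspace $V$.
   Context: A toric subspace of $T^n$ is the image under the quotient map $\mathbb{R}^n\to\mathbb{R}^n/\mathbb{Z}^n$ of an affine subspace $V=\{\vec v\in\mathbb{R}^n: A\vec v=\vec b\}$ where $A$ has rational entries and $\vec b$ is a real vector; if $V$ has dimension $k$, its image is homeomorphic to a $k$-dimensional torus and is called a $k$-dimensional toric subspace. A valuation on $L$ is a function $v$ from $L$ to an abelian group with $v(\emptyset)=0$ and $v(A)+v(B)=v(A\cap B)+v(A\cup B)$ for all $A,B\in L$. *)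

(* Defs.v *)
From HB Require Import structures.
From mathcomp Require Import all_boot all_order all_algebra.
From mathcomp Require Import all_classical all_reals measurable_structure.

Set Implicit Arguments.
Unset Strict Implicit.
Unset Printing Implicit Defensive.

Import Order.TTheory GRing.Theory Num.Theory.
Local Open Scope classical_set_scope.
Local Open Scope quotient_scope.
Local Open Scope ring_scope.

Definition integer_vector (R : realType) (n : nat) : {pred 'cV[R]_n} :=
  fun x => x \is a mxOver Num.int.

Lemma integer_vector_zmod_closed (R : realType) (n : nat) :
  zmod_closed (@integer_vector R n).
Proof.
have hZ x : (x \in @integer_vector R n) = (x \is a mxOver Num.int) by [].
split=> [|x y]; rewrite !hZ; first by rewrite mxOver0 // rpred0.
move=> /mxOverP hx /mxOverP hy; apply/mxOverP => i j.
by rewrite !mxE rpredB ?hx ?hy.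
Qed.

HB.instance Definition _ (R : realType) (n : nat) :=
  GRing.isZmodClosed.Build 'cV[R]_n (@integer_vector R n)
    (integer_vector_zmod_closed R n).

Definition torus (R : realType) (n : nat) : zmodType :=
  Quotient.quot (@integer_vector R n).

Definition torus_proj (R : realType) (n : nat) (x : 'cV[R]_n) : torus R n :=
  \pi_(Quotient.quot (@integer_vector R n)) x.

Lemma torus_proj_eq (R : realType) (n : nat) (x y : 'cV[R]_n) :
  torus_proj x = torus_proj y <-> forall i, x i 0 - y i 0 \is a Num.int.
Proof.
transitivity (is_true (x - y \is a mxOver Num.int)).
  by split=> [|h]; [move/eqP|apply/eqP]; rewrite -Quotient.idealrBE.
split=> [/mxOverP h i|h]; first by have := h i 0; rewrite !mxE.
by apply/mxOverP => i j; rewrite ord1 !mxE; exact: h.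
Qed.

Section ToricSubspaces.
Variables (R : realType) (n : nat).

(* Inconsistent systems are excluded: an affine subspace is nonempty. *)
Definition rational_affine_subspace (V : set 'cV[R]_n) : Prop :=
  V !=set0 /\
  exists (m : nat) (A : 'M[rat]_(m, n)) (b : 'cV[R]_m),
    V = [set x | map_mx ratr A *m x = b].

Definition affine_dim (V : set 'cV[R]_n) (k : nat) : Prop :=
  exists (x0 : 'cV[R]_n) (U : {vspace 'cV[R]_n}),
    V = [set x0 + u | u in [set` U]] /\ \dim U = k.

Definition toric_subspace (W : set (torus R n)) : Prop :=
  exists2 V, rational_affine_subspace V & W = @torus_proj R n @` V.

Definition toric_subspace_dim (k : nat) (W : set (torus R n)) : Prop :=
  exists V, [/\ rational_affine_subspace V, affine_dim V k &
                W = @torus_proj R n @` V].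

Definition toric_intersections : set (set (torus R n)) :=
  [set S | exists (q : nat) (W : 'I_q -> set (torus R n)),
    [/\ (0 < q)%N, forall i, toric_subspace (W i) &
        S = \bigcap_(i in [set: 'I_q]) W i]].

Definition toric_lattice : set (set (torus R n)) :=
  smallest [set L | [/\ setI_closed L, setU_closed L & setC_closed L]]
    toric_intersections.

End ToricSubspaces.

(* [v] is total for convenience; its values outside [L] are unconstrained. *)
Definition valuation (T : Type) (M : zmodType) (L : set (set T))
    (v : set T -> M) : Prop :=
  v set0 = 0 /\
  forall A B, L A -> L B -> v A + v B = v (A `&` B) + v (A `|` B).

(* Main.v *)
Require Import Defs.
From mathcomp Require Import all_boot all_order all_algebra.
From mathcomp Require Import all_classical all_reals measurable_structure.
Set Implicit Arguments.
Unset Strict Implicit.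
Unset Printing Implicit Defensive.
Import Order.TTheory GRing.Theory Num.Theory.
Local Open Scope classical_set_scope.
Local Open Scope ring_scope.

(** A toric subspace is a coset of a subgroup pr (ker N) with N an integer matrix.
    Such subgroups are divisible, and the intersection of two of them contains a
    third one with finite index. By divisibility a proper subgroup has infinite
    index, so (as in B. H. Neumann's lemma) a toric subspace is never covered by
    finitely many toric subspaces not containing it; hence the indicators of
    distinct toric subspaces are linearly independent over Z. By the finite index
    property the span of these indicators is closed under products, so it contains
    the indicator of every member of the lattice. Therefore writing the indicator
    of A as the sum of the c_i 1_(W_i) and putting v(A) := sum of the
    c_i t^(dim W_i) is unambiguous, and v is additive. *)

(** * Subgroups, cosets and coverings *)

Section Subgroups.
Variable T : zmodType.
Implicit Types (H K : set T) (x y c : T).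

Definition subgroup H := H 0 /\ forall x y, H x -> H y -> H (x - y).

Definition divisible H :=
  forall (k : nat) x, (0 < k)%N -> H x -> exists2 y, H y & x = y *+ k.

Definition coset x H : set T := [set y | H (y - x)].

Lemma subgroupN H x : subgroup H -> H x -> H (- x).
Proof. by case=> H0 HB Hx; rewrite -(sub0r x); apply: HB. Qed.

Lemma subgroupD H x y : subgroup H -> H x -> H y -> H (x + y).
Proof.
by move=> sH Hx Hy; rewrite -(opprK y); apply: sH.2 => //; apply: subgroupN.
Qed.

Lemma subgroupMn H x k : subgroup H -> H x -> H (x *+ k).
Proof.
move=> sH Hx; elim: k => [|k IHk]; first by rewrite mulr0n; exact: sH.1.
by rewrite mulrS; apply: subgroupD.
Qed.

Lemma coset_refl x H : subgroup H -> coset x H x.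
Proof. by case=> H0 _; rewrite /coset/= subrr. Qed.

Lemma coset_eq x y H : subgroup H -> coset x H y -> coset x H = coset y H.
Proof.
move=> sH xy; apply/seteqP; split=> z /= zH.
  by have := sH.2 _ _ zH xy; rewrite opprB addrA subrK.
by have := subgroupD sH zH xy; rewrite addrA subrK.
Qed.

Lemma coset_sub x y H K :
  subgroup H -> subgroup K -> coset x H `<=` coset y K -> H `<=` K.
Proof.
move=> sH sK HK z Hz.
have zx : coset y K (z + x) by apply: HK; rewrite /coset/= addrK.
have := sK.2 _ _ zx (HK x (coset_refl x sH)).
by rewrite opprB addrA subrK addrK.
Qed.

(** Each t in s rules out at most one of the size s + 1 indices 0, ..., size s, so some index
    survives. *)
Lemma pigeonhole_avoid (I : eqType) (s : seq I) (P : I -> nat -> Prop) :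
    (forall t i j, t \in s -> (i < j <= size s)%N -> P t i -> P t j -> False) ->
  exists2 k, (k <= size s)%N & forall t, t \in s -> ~ P t k.
Proof.
move=> uniqP; apply: contrapT => noK.
have /choice [f fP] (k : 'I_(size s).+1) :
    exists i : 'I_(size s), exists2 t, t \in s & index t s = i /\ P t k.
  apply: contrapT => noi; apply: noK; exists k; first by rewrite -ltnS.
  move=> t ts Ptk; apply: noi.
  have it : (index t s < size s)%N by rewrite index_mem.
  by exists (Ordinal it), t.
have: injective f.
  move=> i j; case: (fP i) (fP j) => t ts [ti Pi] [t' ts' [tj Pj]] fij.
  have tt' : t' = t by rewrite -(nth_index t ts) ti fij -tj nth_index.
  rewrite {}tt' in Pj {tj ts'}.
  apply/val_inj; apply: contrapT => /eqP; rewrite neq_ltn => /orP[] ij.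
    by apply: (uniqP t i j) => //; rewrite ij -ltnS ltn_ord.
  by apply: (uniqP t j i) => //; rewrite ij -ltnS ltn_ord.
by move/leq_card; rewrite !card_ord ltnn.
Qed.

(** Avoiding this set for m = (size s)! keeps every multiple x *+ k with 0 < k <= size s outside a
    subgroup K, since k divides m. *)
Definition scaled_preimage (m : nat) K : set T := [set x | K (x *+ m)].

Lemma scaled_preimage_subgroup m K : subgroup K -> subgroup (scaled_preimage m K).
Proof.
move=> sK; split=> [|x y]; rewrite /scaled_preimage/= ?mul0rn; first exact: sK.1.
by rewrite mulrnBl; exact: sK.2.
Qed.

(** By divisibility every element of H is m times an element of H, so m H inside K would force H
    inside K. *)
Lemma scaled_preimage_proper m H K : (0 < m)%N -> divisible H ->
  ~ H `<=` K -> ~ H `<=` scaled_preimage m K.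
Proof.
by move=> m0 dH HK HmK; apply: HK => x /(dH _ _ m0)[y Hy ->]; apply: HmK.
Qed.

(** Induction on the number of subgroups. Choose w1 outside the scaled preimages of the tail and w2
    outside K. If w1 lies in K, every w2 + w1 *+ k is outside K, and each other subgroup contains at
    most one of them for k <= size s, since the difference of two is a small multiple of w1. *)
Lemma avoid_subgroups H (s : seq (set T)) : subgroup H -> divisible H ->
    (forall K, K \in s -> subgroup K /\ ~ H `<=` K) ->
  exists2 w, H w & forall K, K \in s -> ~ K w.
Proof.
move=> sH dH; have [m] := ubnP (size s); elim: m s => // m IHm [|K s] /= ltm sP.
  by exists 0; [exact: sH.1|].
pose N := (size s)`!.
have [w1 Hw1 w1P] : exists2 w, H w &
    forall K', K' \in map (scaled_preimage N) s -> ~ K' w.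
  apply: IHm => [|_ /mapP[K' K's ->]]; first by rewrite size_map.
  have [sK' HK'] := sP K' (mem_behead (s := K :: s) K's).
  split; first exact: scaled_preimage_subgroup.
  by apply: scaled_preimage_proper => //; exact: fact_gt0.
have w1k K' k : K' \in s -> (0 < k <= size s)%N -> ~ K' (w1 *+ k).
  move=> K's kP K'w; have [sK' _] := sP K' (mem_behead (s := K :: s) K's).
  apply: (w1P (scaled_preimage N K')); first exact: map_f.
  have /dvdnP[q Nq] : (k %| N)%N := dvdn_fact kP.
  by rewrite /scaled_preimage/= Nq mulnC mulrnA; exact: subgroupMn.
have [sK HK] := sP K (mem_head _ _).
have [w2 Hw2 Kw2] : exists2 w, H w & ~ K w.
  apply: contrapT => h; apply: HK => w Hw.
  by apply: contrapT => Kw; apply: h; exists w.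
have [Kw1|Kw1] := pselect (K w1); last first.
  exists w1 => // K'; rewrite in_cons => /predU1P[->//|K's].
  (* The multiple k = 1 is allowed because s is nonempty. *)
  by rewrite -(mulr1n w1); apply: w1k => //=; case: (s) K's.
have [k _ kP] : exists2 k, (k <= size s)%N &
    forall K', K' \in s -> ~ K' (w2 + w1 *+ k).
  apply: (@pigeonhole_avoid _ s (fun K' k => K' (w2 + w1 *+ k))) => K' i j K's.
  move=> /andP[ij js] Ki Kj; have [sK' _] := sP K' (mem_behead (s := K :: s) K's).
  apply: (w1k K' (j - i)%N) => //.
    by rewrite subn_gt0 ij (leq_trans (leq_subr _ _)).
  by have := sK'.2 _ _ Kj Ki; rewrite opprD addrACA subrr add0r mulrnBr // ltnW.
exists (w2 + w1 *+ k); first by apply: subgroupD => //; exact: subgroupMn.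
move=> K'; rewrite in_cons => /predU1P[-> Kw|]; last exact: kP.
by apply: Kw2; rewrite -(addrK (w1 *+ k) w2); apply: sK.2 => //; exact: subgroupMn.
Qed.

(* Neumann's lemma: every proper subgroup of a divisible group has infinite
   index, so finitely many cosets of such subgroups cannot cover the group. *)
Lemma avoid_cosets H (s : seq (T * set T)) : subgroup H -> divisible H ->
    (forall p, p \in s -> subgroup p.2 /\ ~ H `<=` p.2) ->
  exists2 w, H w & forall p, p \in s -> ~ coset p.1 p.2 w.
Proof.
move=> sH dH sP; pose N := (size s)`!.
have [w Hw wP] : exists2 w, H w &
    forall K, K \in [seq scaled_preimage N p.2 | p <- s] -> ~ K w.
  apply: avoid_subgroups => // _ /mapP[p ps ->]; have [sp Hp] := sP p ps.
  split; first exact: scaled_preimage_subgroup.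
  by apply: scaled_preimage_proper => //; exact: fact_gt0.
(* Two multiples of w in one coset would put w *+ (j - i), hence w *+ N, in its subgroup; so each
   coset catches at most one of these multiples. *)
have [k _ kP] : exists2 k, (k <= size s)%N &
    forall p, p \in s -> ~ coset p.1 p.2 (w *+ k).
  apply: (@pigeonhole_avoid _ s (fun p k => coset p.1 p.2 (w *+ k))) => p i j ps.
  move=> /andP[ij js] Ki Kj; have [sp _] := sP p ps.
  apply: (wP (scaled_preimage N p.2)); first exact: (map_f (fun p => _ p.2)).
  have /dvdnP[q Nq] : (j - i %| N)%N.
    by apply: dvdn_fact; rewrite subn_gt0 ij (leq_trans (leq_subr _ _)).
  rewrite /scaled_preimage/= Nq mulnC mulrnA; apply: subgroupMn => //.
  by have := sp.2 _ _ Kj Ki; rewrite opprB addrA subrK mulrnBr // ltnW.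
by exists (w *+ k) => //; exact: subgroupMn.
Qed.

End Subgroups.

(** * Integer combinations of indicators of cosets *)

Section Combinations.
Variable T : zmodType.
Implicit Types (H K W A B : set T) (x y c : T) (s : seq (int * set T)).

Definition finite_index H K :=
  exists r : seq T, forall x, K x -> exists2 c, c \in r & H (x - c).

(** One point of K in each fibre of g that meets K gives finitely many representatives; fibres
    missing K get the dummy 0. *)
Lemma finite_index_fun (I : finType) H K (g : T -> I) :
    (forall x y, K x -> K y -> g x = g y -> H (x - y)) -> finite_index H K.
Proof.
move=> gP.
have /choice [r rP] i : exists c, (exists2 x, K x & g x = i) -> K c /\ g c = i.
  have [[x Kx gx]|nK] := pselect (exists2 x, K x & g x = i); first by exists x.
  by exists 0 => /nK.
exists [seq r i | i <- enum I] => x Kx; have [|Kr gr] := rP (g x); first by exists x.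
by exists (r (g x)); [apply: map_f; rewrite mem_enum|apply: gP].
Qed.

(** What the combinatorial argument needs of the toric subgroups. An intersection of two of them can
    be disconnected, so closure under intersection is only asked up to finite index. *)
Record coset_system (F : set (set T)) : Prop := CosetSystem {
  system_setT : F setT;
  system_subgroup : forall H, F H -> subgroup H;
  system_divisible : forall H, F H -> divisible H;
  system_setI : forall H K, F H -> F K ->
    exists2 J, F J & J `<=` H `&` K /\ finite_index J (H `&` K) }.

(** The list s is a formal integer combination of sets. Taking [delta] to be [ind x] evaluates it at
    x; taking the power of t given by the dimension yields the valuation. *)
Definition weigh (M : zmodType) (delta : set T -> M) s : M :=
  \sum_(p <- s) delta p.2 *~ p.1.

Definition ind x W : int := (x \in W)%:R.

Definition is_coset (F : set (set T)) W := exists x, exists2 H, F H & W = coset x H.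

Definition combination F s := forall p, p \in s -> is_coset F p.2.

Definition in_span F (f : T -> int) :=
  exists2 s, combination F s & forall x, weigh (ind x) s = f x.

Lemma weigh_cons (M : zmodType) (delta : set T -> M) p s :
  weigh delta (p :: s) = delta p.2 *~ p.1 + weigh delta s.
Proof. by rewrite /weigh big_cons. Qed.

Lemma weigh_cat (M : zmodType) (delta : set T -> M) s1 s2 :
  weigh delta (s1 ++ s2) = weigh delta s1 + weigh delta s2.
Proof. by rewrite /weigh big_cat. Qed.

Definition neg_combination s := [seq (- p.1, p.2) | p <- s].

Lemma weigh_neg (M : zmodType) (delta : set T -> M) s :
  weigh delta (neg_combination s) = - weigh delta s.
Proof.
by rewrite /weigh big_map -sumrN; apply: eq_bigr => p _; rewrite mulrNz.
Qed.

Lemma combination_neg F s : combination F s -> combination F (neg_combination s).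
Proof. by move=> Fs _ /mapP[p /Fs ? ->]. Qed.

Lemma combination_cat F s1 s2 :
  combination F s1 -> combination F s2 -> combination F (s1 ++ s2).
Proof. by move=> F1 F2 p; rewrite mem_cat => /orP[/F1|/F2]. Qed.

(** Translate x to the origin. If the subgroup of W' contains H, then W' contains W or misses it,
    and containment is excluded; the remaining W' are avoided by Neumann's lemma. *)
Lemma avoid_coset_system F W (r : seq (set T)) : coset_system F -> is_coset F W ->
    (forall W', W' \in r -> is_coset F W' /\ ~ W `<=` W') ->
  exists2 x, W x & forall W', W' \in r -> ~ W' x.
Proof.
move=> FF [x [H FH ->]] rP; have sH := system_subgroup FF FH.
have /choice [g gP] W' : exists p : T * set T,
    W' \in r -> F p.2 /\ W' = coset p.1 p.2.
  have [/rP[[x' [H' FH' ->]] _]|_] := boolP (W' \in r); first by exists (x', H').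
  by exists (x, H).
have [w Hw wP] : exists2 w, H w & forall p,
    p \in [seq ((g W').1 - x, (g W').2) | W' <- r & `[< ~ H `<=` (g W').2 >]] ->
    ~ coset p.1 p.2 w.
  apply: avoid_cosets => //; first exact: system_divisible FF _ FH.
  move=> _ /mapP[W' + ->]; rewrite mem_filter => /andP[/asboolP HW' W'r].
  by split=> //; apply: system_subgroup FF _ (gP W' W'r).1.
have wx : coset x H (x + w) by rewrite /coset/= addrC addKr.
exists (x + w) => // W' W'r W'w; have [FW' W'E] := gP W' W'r.
have sW' := system_subgroup FF FW'.
have [HW'|HW'] := pselect (H `<=` (g W').2).
  apply: (rP W' W'r).2; rewrite (coset_eq sH wx) W'E.
  by rewrite (@coset_eq _ _ (x + w)) // -?W'E // => z; exact: HW'.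
apply: (wP ((g W').1 - x, (g W').2)).
  by apply/mapP; exists W' => //; rewrite mem_filter W'r andbT; apply/asboolP.
by move: W'w; rewrite {1}W'E /coset/= opprB addrA (addrC w).
Qed.

Lemma exists_maximal (r : seq (set T)) : r != [::] ->
  exists2 W, W \in r & forall W', W' \in r -> W `<=` W' -> W' = W.
Proof.
elim: r => // A r IHr _; have [->|/IHr[W Wr WP]] := eqVneq r [::].
  by exists A; rewrite ?mem_head // => W'; rewrite inE => /eqP.
have [WA|WA] := pselect (W `<=` A).
  exists A; rewrite ?mem_head // => W'; rewrite in_cons => /predU1P[//|W'r AW'].
  apply/seteqP; split=> //; rewrite (WP W') //; exact: subset_trans AW'.
exists W; first by rewrite in_cons Wr orbT.
by move=> W'; rewrite in_cons => /predU1P[-> /WA|/WP].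
Qed.

(* Evaluating at a point of a maximal W that avoids all the other sets isolates
   the total coefficient of W. *)
Lemma ind_independent F s (M : zmodType) (delta : set T -> M) :
    coset_system F -> combination F s -> (forall x, weigh (ind x) s = 0) ->
  weigh delta s = 0.
Proof.
move=> FF; have [m] := ubnP (size s); elim: m s => // m IHm s ltm Fs s0.
have [->|s_n0] := eqVneq s [::]; first by rewrite /weigh big_nil.
have [|W /mapP[p0 p0s Wp0] Wmax] := @exists_maximal [seq p.2 | p <- s].
  by case: (s) s_n0.
pose s1 := [seq p <- s | p.2 == W]; pose s2 := [seq p <- s | p.2 != W].
(* Stated for all weights, as it serves both for [ind x] and for [delta]. *)
have split_s (M' : zmodType) (d : set T -> M') :
    weigh d s = d W *~ (\sum_(p <- s1) p.1) + weigh d s2.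
  rewrite /weigh (bigID (fun p => p.2 == W)) /= -!(big_filter s); congr (_ + _).
  rewrite mulrz_sumr; apply: eq_big_seq => p.
  by rewrite mem_filter => /andP[/eqP->].
have [x Wx xP] : exists2 x, W x & forall W', W' \in [seq p.2 | p <- s2] -> ~ W' x.
  apply: (avoid_coset_system FF); first by rewrite Wp0; exact: Fs.
  move=> _ /mapP[p + ->]; rewrite mem_filter => /andP[pW ps]; split; first exact: Fs.
  by move=> Wp; move: pW; rewrite (Wmax p.2) ?eqxx //; exact: map_f.
have s2x : weigh (ind x) s2 = 0.
  rewrite /weigh big_seq big1 // => p ps2; rewrite /ind memNset ?mul0rz //.
  by apply: xP; exact: map_f.
have c0 : \sum_(p <- s1) p.1 = 0.
  by have := split_s _ (ind x); rewrite s0 s2x addr0 /ind mem_set //= intz.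
(* Since W has total coefficient 0, dropping it changes no weight, and s2 is shorter because it
   omits p0. *)
rewrite split_s c0 mulr0z add0r; apply: IHm.
- rewrite -ltnS; apply: leq_trans ltm; rewrite ltnS size_filter.
  rewrite -(count_predC (fun p => p.2 == W) s) -[X in (X < _)%N]add0n.
  by rewrite ltn_add2r -has_count; apply/hasP; exists p0; rewrite ?Wp0.
- by move=> p; rewrite mem_filter => /andP[_ /Fs].
- by move=> y; have := split_s _ (ind y); rewrite s0 c0 mulr0z add0r => <-.
Qed.

(** * The ring spanned by the indicators of cosets *)

Lemma in_span_ext F f g : f =1 g -> in_span F f -> in_span F g.
Proof. by move=> fg [s Fs sf]; exists s => // x; rewrite sf. Qed.

Lemma in_span0 F : in_span F (fun=> 0).
Proof. by exists [::] => // x; rewrite /weigh big_nil. Qed.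

Lemma in_spanD F f g : in_span F f -> in_span F g -> in_span F (fun x => f x + g x).
Proof.
move=> [s Fs sf] [s' Fs' sg]; exists (s ++ s'); first exact: combination_cat.
by move=> x; rewrite weigh_cat sf sg.
Qed.

Lemma in_spanN F f : in_span F f -> in_span F (fun x => - f x).
Proof.
move=> [s Fs sf]; exists (neg_combination s); first exact: combination_neg.
by move=> x; rewrite weigh_neg sf.
Qed.

Lemma in_spanZ F (c : int) f : in_span F f -> in_span F (fun x => f x * c).
Proof.
move=> [s Fs sf]; exists [seq (p.1 * c, p.2) | p <- s].
  by move=> _ /mapP[p /Fs ? ->].
move=> x; rewrite -sf /weigh big_map mulr_suml; apply: eq_bigr => p _ /=.
by rewrite !mulrzz mulrA.
Qed.

Lemma in_span_coset F W : is_coset F W -> in_span F (ind^~ W).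
Proof.
move=> FW; exists [:: (1, W)]; first by move=> p; rewrite inE => /eqP->.
by move=> x; rewrite /weigh big_seq1.
Qed.

(* The nonempty intersection of two cosets is the disjoint union of the finitely
   many cosets of J that it meets. *)
Lemma in_span_cosetI F W1 W2 : coset_system F -> is_coset F W1 -> is_coset F W2 ->
  in_span F (fun x => ind x W1 * ind x W2).
Proof.
move=> FF [x1 [H FH ->]] [x2 [K FK ->]].
have [sH sK] := (system_subgroup FF FH, system_subgroup FF FK).
have [noy|] := pselect (~ exists y, coset x1 H y /\ coset x2 K y).
  apply: in_span_ext (in_span0 F) => x; rewrite /ind.
  have [/set_mem xH|_] := boolP (x \in coset x1 H); last by rewrite mul0r.
  rewrite mul1r memNset // => xK.
  by apply: noy; exists x.
move=> /contrapT[y [Hy Ky]]; rewrite (coset_eq sH Hy) (coset_eq sK Ky).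
have [J FJ [JHK [r rP]]] := system_setI FF FH FK; have sJ := system_subgroup FF FJ.
(* Keeping only representatives in both H and K places these cosets inside the intersection; [undup]
   makes them distinct, hence disjoint. *)
pose D := undup [seq coset (y + c) J | c <- r & c \in H `&` K].
exists [seq (1, W) | W <- D].
  move=> _ /mapP[W + ->]; rewrite mem_undup => /mapP[c _ ->].
  by exists (y + c), J.
move=> x; rewrite /weigh big_map.
(* The coset of J through x is the only one containing x, so the sum tells whether it occurs in
   D. *)
transitivity (\sum_(W <- D) (W == coset x J)%:R : int).
  apply: eq_big_seq => W; rewrite mem_undup => /mapP[c _ ->] /=; rewrite mulr1z.
  rewrite /ind; congr (_%:R); congr nat_of_bool; apply/idP/eqP => [/set_mem|->].
    exact: coset_eq.
  by apply/mem_set; exact: coset_refl.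
have HKx z : (z \in coset y H `&` coset y K) = (z - y \in H `&` K).
  by apply/idP/idP => /set_mem ?; apply/mem_set.
rewrite -natr_sum -(big_map _ predT id) -sumnE sumn_count.
rewrite count_uniq_mem ?undup_uniq //.
rewrite mem_undup /ind -natrM mulnb -in_setI HKx; congr (_%:R); congr nat_of_bool.
apply/mapP/idP => [[c]|/set_mem xHK].
  rewrite mem_filter => /andP[/set_mem[Hc Kc] _] xc; apply/mem_set.
  have [HJ KJ] : (H `&` K) (x - y - c).
    apply: JHK; suff: coset (y + c) J x by rewrite /coset/= opprD addrA.
    by rewrite -xc; exact: coset_refl.
  by split; rewrite -(subrK c (x - y)); exact: subgroupD.
(* The representative c survives the filter because c = (x - y) - (x - y - c) lies in H and in K. *)
have [c cr Jc] := rP _ xHK; have [HJ KJ] := JHK _ Jc.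
exists c; last first.
  by apply/esym/coset_eq => //; rewrite /coset/= opprD addrA.
rewrite mem_filter cr andbT; apply/mem_set; case: xHK => Hx Kx.
by split; rewrite -(subKr (x - y) c); [apply: sH.2|apply: sK.2].
Qed.

(** Expanding both combinations reduces this to products of two coset indicators. *)
Lemma in_spanM F f g : coset_system F ->
  in_span F f -> in_span F g -> in_span F (fun x => f x * g x).
Proof.
move=> FF [s Fs sf] [s' Fs' sg].
apply: (@in_span_ext _ (fun x => weigh (ind x) s * weigh (ind x) s')).
  by move=> x; rewrite sf sg.
elim: s Fs {f sf} => [_|p s IHs Fs].
  by apply: in_span_ext (in_span0 F) => x; rewrite /weigh big_nil mul0r.
have Fp := Fs p (mem_head _ _).
apply: (@in_span_ext _ (fun x => ind x p.2 * weigh (ind x) s' * p.1 +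
    weigh (ind x) s * weigh (ind x) s')).
  by move=> x; rewrite weigh_cons mulrDl mulrzz mulrAC.
apply: in_spanD; last by apply: IHs => q qs; apply: Fs; rewrite in_cons qs orbT.
apply: in_spanZ; elim: s' Fs' {g sg IHs} => [_|q s' IHs Fs'].
  by apply: in_span_ext (in_span0 F) => x; rewrite /weigh big_nil mulr0.
apply: (@in_span_ext _ (fun x => ind x p.2 * ind x q.2 * q.1 +
    ind x p.2 * weigh (ind x) s')).
  by move=> x; rewrite weigh_cons mulrDr mulrzz mulrA.
apply: in_spanD; last by apply: IHs => r rs; apply: Fs'; rewrite in_cons rs orbT.
by apply/in_spanZ/in_span_cosetI => //; apply: Fs'; exact: mem_head.
Qed.

(** * Spanned sets and their valuation *)

Definition spanned F : set (set T) := [set A | in_span F (ind^~ A)].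

Lemma spanned_setT F : coset_system F -> spanned F setT.
Proof.
move=> FF; apply: in_span_coset; exists 0, setT; first exact: system_setT.
by apply/seteqP; split.
Qed.

Lemma spanned_setI F : coset_system F -> setI_closed (spanned F).
Proof.
move=> FF A B FA FB; apply: in_span_ext (in_spanM FF FA FB) => x.
by rewrite /ind in_setI -mulnb natrM.
Qed.

Lemma spanned_setC F : coset_system F -> setC_closed (spanned F).
Proof.
move=> FF A FA.
apply: in_span_ext (in_spanD (spanned_setT FF) (in_spanN FA)) => x.
by rewrite /ind in_setC in_setT; case: (x \in A).
Qed.

Lemma spanned_setU F : coset_system F -> setU_closed (spanned F).
Proof.
move=> FF A B FA FB; rewrite -[A `|` B]setCK setCU.
by apply: spanned_setC => //; apply: spanned_setI => //; exact: spanned_setC.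
Qed.

Lemma coset_valuation F (M : zmodType) (delta : set T -> M) : coset_system F ->
  exists2 v : set T -> M, valuation (spanned F) v &
    forall W, is_coset F W -> v W = delta W.
Proof.
move=> FF.
have /choice [rep repP] A : exists s, spanned F A ->
    combination F s /\ forall x, weigh (ind x) s = ind x A.
  have [[s Fs sA]|nA] := pselect (spanned F A); first by exists s.
  by exists [::] => /nA.
pose v A := weigh delta (rep A).
(* Independence, applied to the difference of two combinations, makes the weight independent of the
   choice of [rep A]. *)
have vE A s : combination F s -> (forall x, weigh (ind x) s = ind x A) ->
    v A = weigh delta s.
  move=> Fs sA; have [|Fr rA] := repP A; first by exists s.
  apply/eqP; rewrite -subr_eq0 -weigh_neg -weigh_cat; apply/eqP.
  apply: (ind_independent delta FF) => [|x].
    by apply: combination_cat => //; exact: combination_neg.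
  by rewrite weigh_cat weigh_neg rA sA subrr.
exists v => [|W FW]; last first.
  rewrite (vE W [:: (1, W)]) => [||x]; last by rewrite /weigh big_seq1.
    by rewrite /weigh big_seq1.
  by move=> p; rewrite inE => /eqP->.
split=> [|A B FA FB].
  rewrite (vE set0 [::]) => // [|x]; first by rewrite /weigh big_nil.
  by rewrite /weigh big_nil /ind in_set0.
have [[FrA rA] [FrB rB]] := (repP A FA, repP B FB).
have [FrI rI] := repP _ (spanned_setI FF FA FB).
have [FrU rU] := repP _ (spanned_setU FF FA FB).
(* Pointwise, the indicators of A and B sum to those of the intersection and the union, so the
   difference of the combinations has weight 0. *)
apply/eqP; rewrite -subr_eq0 /v -!weigh_cat -weigh_neg -weigh_cat; apply/eqP.
apply: (ind_independent delta FF) => [|x].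
  by apply: combination_cat; [|apply: combination_neg]; exact: combination_cat.
rewrite !(weigh_cat, weigh_neg) rA rB rI rU /ind in_setI in_setU.
by case: (x \in A); case: (x \in B).
Qed.

End Combinations.

(** * Toric subspaces *)

Section Torus.
Variables (R : realType) (n : nat).
Local Notation T := (torus R n).
Local Notation pr := (@torus_proj R n).
Local Notation intmx N := (map_mx (intr : int -> R) N).

Lemma torus_projB : {morph pr : x y / x - y}.
Proof. exact: (raddfB (\pi_(Quotient.quot (@integer_vector R n))%qT)). Qed.

Lemma torus_proj0 : pr 0 = 0.
Proof. exact: (raddf0 (\pi_(Quotient.quot (@integer_vector R n))%qT)). Qed.

Lemma torus_projD : {morph pr : x y / x + y}.
Proof. exact: (raddfD (\pi_(Quotient.quot (@integer_vector R n))%qT)). Qed.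

Lemma torus_projMn k : {morph pr : x / x *+ k}.
Proof. exact: (raddfMn (\pi_(Quotient.quot (@integer_vector R n))%qT)). Qed.

Lemma torus_proj_surj (t : T) : exists x, pr x = t.
Proof. by exists (repr t); exact: reprK. Qed.

Lemma torus_proj_eqP x y : pr x = pr y <-> x - y \is a mxOver Num.int.
Proof.
rewrite torus_proj_eq; split=> [h|/mxOverP h i]; last by have := h i 0; rewrite !mxE.
by apply/mxOverP => i j; rewrite ord1 !mxE; exact: h.
Qed.

(** An integer matrix N induces a homomorphism of tori. The image of its real kernel is connected
    and may be smaller than the kernel of that homomorphism. *)
Definition toric_subgroup m (N : 'M[int]_(m, n)) : set T :=
  pr @` [set x | intmx N *m x = 0].

Lemma intmx_int p q (N : 'M[int]_(p, q)) : intmx N \is a mxOver Num.int.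
Proof. by apply/mxOverP => i j; rewrite mxE intr_int. Qed.

Lemma toric_subgroup_int m (N : 'M[int]_(m, n)) y :
  toric_subgroup N (pr y) -> intmx N *m y \is a mxOver Num.int.
Proof.
move=> [x /= Nx /esym/torus_proj_eqP yx].
by rewrite -(subrK x y) mulmxDr Nx addr0 mxOverM ?intmx_int.
Qed.

Lemma toric_subgroup_subgroup m (N : 'M[int]_(m, n)) : subgroup (toric_subgroup N).
Proof.
split=> [|_ _ [x /= Nx <-] [y /= Ny <-]].
  by exists 0; rewrite /= ?mulmx0 // torus_proj0.
by exists (x - y); rewrite /= ?torus_projB // mulmxBr Nx Ny subrr.
Qed.

Lemma toric_subgroup_divisible m (N : 'M[int]_(m, n)) :
  divisible (toric_subgroup N).
Proof.
move=> k _ k0 [x /= Nx <-]; exists (pr (k%:R^-1 *: x)).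
  by exists (k%:R^-1 *: x) => //=; rewrite -scalemxAr Nx scaler0.
by rewrite -torus_projMn -scaler_nat scalerA divff ?scale1r // pnatr_eq0 -lt0n.
Qed.

Lemma toric_coset m (N : 'M[int]_(m, n)) (b : 'cV[R]_m) (x0 : 'cV[R]_n) :
    intmx N *m x0 = b ->
  pr @` [set x | intmx N *m x = b] = coset (pr x0) (toric_subgroup N).
Proof.
move=> Nx0; apply/seteqP; split=> [_ [x /= Nx <-]|t [x /= Nx xt]].
  by exists (x - x0); rewrite /= ?torus_projB // mulmxBr Nx Nx0 subrr.
exists (x + x0); first by rewrite /= mulmxDr Nx add0r.
by rewrite torus_projD xt subrK.
Qed.

(** * Integer equations and finite index of intersections *)

Lemma clear_denominators p q (A : 'M[rat]_(p, q)) :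
  exists2 d : nat, (0 < d)%N &
    exists N : 'M[int]_(p, q), d%:R *: A = map_mx intr N.
Proof.
pose D := \prod_(ij : 'I_p * 'I_q) denq (A ij.1 ij.2).
have D0 : 0 < D by apply: prodr_gt0 => ij _; exact: denq_gt0.
exists `|D|%N; first by rewrite absz_gt0 gt_eqF.
(* The entry is D times A i j: the other denominators times the numerator. *)
exists (\matrix_(i, j)
  (\prod_(ij | ij != (i, j)) denq (A ij.1 ij.2) * numq (A i j))).
apply/matrixP => i j; rewrite !mxE pmulrn gtz0_abs // /D (bigD1 (i, j)) //=.
by rewrite !intrM (numqE (A i j)) [LHS]mulrC [LHS]mulrA [LHS]mulrC.
Qed.

Lemma map_ratr_intmx p q (N : 'M[int]_(p, q)) :
  map_mx (ratr : rat -> R) (map_mx intr N) = intmx N.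
Proof. by apply/matrixP => i j; rewrite !mxE ratr_int. Qed.

(** N Q acts as multiplication by d on the image of N; residues modulo d will bound the index of an
    intersection. *)
Lemma int_pseudoinverse p q (N : 'M[int]_(p, q)) :
  exists2 d : nat, (0 < d)%N &
    exists Q : 'M[int]_(q, p), intmx N *m intmx Q *m intmx N = d%:R *: intmx N.
Proof.
pose A : 'M[rat]_(p, q) := map_mx intr N.
have [d d0 [Q dQ]] := clear_denominators (pinvmx A).
exists d => //; exists Q; rewrite -!map_ratr_intmx -/A -dQ -!map_mxM.
by rewrite -scalemxAr -scalemxAl mulmxKpV // map_mxZ rmorph_nat.
Qed.

Lemma rational_affine_subspace_int (V : set 'cV[R]_n) :
  rational_affine_subspace V ->
  exists (m : nat) (N : 'M[int]_(m, n)) (b : 'cV[R]_m),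
    V = [set x | intmx N *m x = b].
Proof.
move=> [_ [m [A [b ->]]]]; have [d d0 [N dA]] := clear_denominators A.
have dA' : intmx N = d%:R *: map_mx ratr A.
  have := congr1 (map_mx (ratr : rat -> R)) dA.
  by rewrite map_mxZ rmorph_nat map_ratr_intmx.
have dn0 : d%:R != 0 :> R by rewrite pnatr_eq0 -lt0n.
exists m, N, (d%:R *: b); apply/seteqP; split=> x /=; rewrite dA' -scalemxAl.
  by move=> ->.
by move/(scalerI dn0).
Qed.

(** For t in both subgroups, N (lift t) is integral, hence so is c t = Q N (lift t). If c s and c t
    agree modulo the constant of the pseudo-inverse, an integer vector corrects lift s - lift t into
    the kernel of N. *)
Lemma toric_setI_finite_index m1 m2 (N1 : 'M[int]_(m1, n)) (N2 : 'M[int]_(m2, n)) :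
  finite_index (toric_subgroup (col_mx N1 N2))
    (toric_subgroup N1 `&` toric_subgroup N2).
Proof.
have [[//|d] _ [Q NQ]] := int_pseudoinverse (col_mx N1 N2).
set N := col_mx N1 N2 in NQ *.
have /choice [lift liftP] := torus_proj_surj.
pose c t := intmx Q *m (intmx N *m lift t).
(* On the intersection the entries of c t are integers, so the floor merely transports them to
   [int]. *)
pose g t : 'cV['I_d.+1]_n := \col_i inord `|(Num.floor (c t i 0%R) %% d.+1%:Z)%Z|.
apply: (finite_index_fun (g := g)) => s t [sN1 sN2] [tN1 tN2] gst.
have c_int u : toric_subgroup N1 u -> toric_subgroup N2 u ->
    c u \is a mxOver Num.int.
  rewrite -(liftP u) => /toric_subgroup_int uN1 /toric_subgroup_int uN2.
  rewrite liftP in uN1 uN2 *.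
  rewrite /c mxOverM ?intmx_int // map_col_mx mul_col_mx.
  apply/mxOverP => i j; rewrite mxE.
  by case: splitP => k _; [move: uN1|move: uN2] => /mxOverP.
have [z z_int cz] : exists2 z : 'cV[R]_n, z \is a mxOver Num.int &
    c s - c t = d.+1%:R *: z.
  exists (\col_i ((Num.floor (c s i 0%R) - Num.floor (c t i 0%R))%R %/ d.+1%:Z)%Z%:~R).
    by apply/mxOverP => i j; rewrite mxE intr_int.
  apply/colP => i; rewrite !mxE.
  have /(congr1 (@nat_of_ord _)) := congr1 (fun M : 'cV['I_d.+1]_n => M i 0) gst.
  have ltd (m : int) : (`|(m %% d.+1%:Z)%Z| < d.+1)%N.
    by rewrite -ltz_nat gez0_abs ?modz_ge0 // ltz_pmod.
  rewrite !mxE !inordK // => /(congr1 Posz); rewrite !gez0_abs ?modz_ge0 // => /eqP.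
  rewrite eqz_mod_dvd => /divzK dvd_st; rewrite -[d.+1%:R]/(d.+1%:Z%:~R) mulrC -intrM.
  have /mxOverP/(_ i 0) cs := c_int s sN1 sN2.
  have /mxOverP/(_ i 0) ct := c_int t tN1 tN2.
  by rewrite !mxE in cs ct; rewrite dvd_st intrB !floorK.
exists (lift s - lift t - z); last first.
  transitivity (pr (lift s - lift t)); last by rewrite torus_projB !liftP.
  by apply/esym/torus_proj_eqP; rewrite subKr.
have dn0 : d.+1%:R != 0 :> R by rewrite pnatr_eq0.
(* With D = d.+1: D N (lift s - lift t) = N Q N (lift s - lift t) = N (c s - c t) = D N z. *)
apply: (scalerI dn0); rewrite scaler0 /= mulmxBr scalerBr scalemxAl.
by rewrite -NQ scalemxAr -cz /c -!mulmxA !mulmxBr subrr.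
Qed.

(** * Toric subspaces as cosets, and their dimension *)

Definition toric_subgroups : set (set T) :=
  [set H | exists m (N : 'M[int]_(m, n)), H = toric_subgroup N].

Lemma toric_coset_system : coset_system toric_subgroups.
Proof.
split.
(* The matrix without rows has the whole space as kernel. *)
- exists 0%N, 0; apply/seteqP; split=> // t _; have [x <-] := torus_proj_surj t.
  by exists x => //=; apply/matrixP => -[].
- by move=> _ [m [N ->]]; exact: toric_subgroup_subgroup.
- by move=> _ [m [N ->]]; exact: toric_subgroup_divisible.
- move=> _ _ [m1 [N1 ->]] [m2 [N2 ->]].
  exists (toric_subgroup (col_mx N1 N2)); first by exists (m1 + m2)%N, (col_mx N1 N2).
  split; last exact: toric_setI_finite_index.
  move=> _ [x /= + <-]; rewrite map_col_mx mul_col_mx => /eqP.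
  by rewrite col_mx_eq0 => /andP[/eqP N1x /eqP N2x]; split; exists x.
Qed.

Lemma toric_subspace_coset W : toric_subspace W -> is_coset toric_subgroups W.
Proof.
move=> [V ratV ->]; have [[x0 Vx0] _] := ratV.
have [m [N [b VE]]] := rational_affine_subspace_int ratV.
exists (pr x0), (toric_subgroup N); first by exists m, N.
by rewrite VE; apply: toric_coset; move: Vx0; rewrite VE.
Qed.

(** The direction space of V is the real kernel of N, which ties the dimension to the subgroup. *)
Lemma toric_subspace_dimE k W : toric_subspace_dim k W ->
  exists m (N : 'M[int]_(m, n)) (x0 : 'cV[R]_n) (U : {vspace 'cV[R]_n}),
    [/\ W = coset (pr x0) (toric_subgroup N), \dim U = k &
        forall u, u \in U <-> intmx N *m u = 0].
Proof.
move=> [V [ratV [x0 [U [VU dU]]] ->]].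
have [m [N [b VE]]] := rational_affine_subspace_int ratV.
have Nx0 : intmx N *m x0 = b.
  have : V x0 by rewrite VU; exists 0; rewrite /= ?mem0v // addr0.
  by rewrite VE.
exists m, N, x0, U; split=> //; first by rewrite VE; exact: toric_coset.
move=> u; split=> [uU|Nu].
  have : V (x0 + u) by rewrite VU; exists u.
  by rewrite VE /= mulmxDr Nx0 -[RHS]addr0 => /addrI.
have : V (x0 + u) by rewrite VE /= mulmxDr Nu addr0.
by rewrite VU => -[u' /= u'U /addrI <-].
Qed.

(* Integrality of N (a u) for every real a forces N u = 0. *)
Lemma toric_subgroup_kernel m1 m2 (N1 : 'M[int]_(m1, n)) (N2 : 'M[int]_(m2, n))
    (u : 'cV[R]_n) :
  toric_subgroup N1 `<=` toric_subgroup N2 ->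
  intmx N1 *m u = 0 -> intmx N2 *m u = 0.
Proof.
move=> N12 N1u; apply/matrixP => i j; rewrite [RHS]mxE.
apply: contrapT => /eqP r0; set r := (_ *m _) i j in r0.
(* The factor (2 r)^-1 turns the nonzero entry r of N2 u into 1/2, which is not an integer. *)
have : toric_subgroup N2 (pr ((2 * r)^-1 *: u)).
  by apply: N12; exists ((2 * r)^-1 *: u) => //=; rewrite -scalemxAr N1u scaler0.
move/toric_subgroup_int/mxOverP/(_ i j); rewrite -scalemxAr mxE -/r invfM mulfVK //.
move=> /intrP[z zE].
have : (2 * z)%:~R = 1%:~R :> R.
  by rewrite intrM -zE rmorph_nat divff // pnatr_eq0.
by move/intr_inj => /(congr1 (fun z => 2 %| z)%Z); rewrite dvdz_mulr.
Qed.

(** A coset determines its subgroup, and the subgroup determines the real kernel of N, hence the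
    dimension. *)
Lemma toric_subspace_dim_uniq k1 k2 (W : set T) :
  toric_subspace_dim k1 W -> toric_subspace_dim k2 W -> k1 = k2.
Proof.
move=> /toric_subspace_dimE[m1 [N1 [x1 [U1 [W1 <- U1P]]]]].
move=> /toric_subspace_dimE[m2 [N2 [x2 [U2 [W2 <- U2P]]]]].
have [sN1 sN2] := (toric_subgroup_subgroup N1, toric_subgroup_subgroup N2).
have N12 : toric_subgroup N1 `<=` toric_subgroup N2.
  by apply: (@coset_sub _ (pr x1) (pr x2)); rewrite -?W1 -?W2.
have N21 : toric_subgroup N2 `<=` toric_subgroup N1.
  by apply: (@coset_sub _ (pr x2) (pr x1)); rewrite -?W1 -?W2.
apply/eqP; rewrite eqn_leq !dimvS //; apply/subvP => u.
  by move=> /U2P/(toric_subgroup_kernel N21)/U1P.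
by move=> /U1P/(toric_subgroup_kernel N12)/U2P.
Qed.

(** The spanned sets contain the generators and are closed under the three operations, so minimality
    of the lattice applies. *)
Lemma toric_lattice_spanned :
  @toric_lattice R n `<=` spanned toric_subgroups.
Proof.
have FF := toric_coset_system.
apply: smallest_sub.
  by split; [exact: spanned_setI|exact: spanned_setU|exact: spanned_setC].
move=> S [q [W [_ torW ->]]].
have -> : [set: 'I_q] = [set` enum 'I_q].
  by apply/seteqP; split=> i //= _; rewrite mem_enum.
rewrite bigcap_seq; elim/big_ind: _ => [|A B FA FB|i _].
- exact: spanned_setT.
- exact: spanned_setI.
- exact/in_span_coset/toric_subspace_coset.
Qed.

End Torus.

Theorem theorem3p4 (R : realType) (n : nat) :
  exists v : set (torus R n) -> {poly int},
    valuation (@toric_lattice R n) v /\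
    (forall (k : nat) (V : set (torus R n)),
       toric_subspace_dim k V -> v V = 'X^k).
Proof.
(* Uniqueness of the dimension makes [delta] well defined; 0 is a dummy on sets that are not toric
   subspaces. *)
have /choice [delta deltaP] (W : set (torus R n)) : exists p : {poly int},
    forall k, toric_subspace_dim k W -> p = 'X^k.
  have [[k Wk]|noW] := pselect (exists k, toric_subspace_dim k W).
    by exists 'X^k => k' /(toric_subspace_dim_uniq Wk)->.
  by exists 0 => k Wk; case: noW; exists k.
have [v [v0 vD] vW] := coset_valuation delta (toric_coset_system R n).
exists v; split.
  by split=> // A B /toric_lattice_spanned ? /toric_lattice_spanned ?; exact: vD.
move=> k V Vk; rewrite vW; first exact: deltaP.
by apply: toric_subspace_coset; case: Vk => U [ratU _ ->]; exists U.
Qed.
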